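(* Let $S$ be a direct limit of a direct system $\{S_i \mid \varphi_{ij}\}$ of semirings over a directed set $I$. Then the following statements are true, both with ''projective'' and with ''strongly projective'' throughout: (1) If $P$ is a finitely generated (strongly) projective right $S$-semimodule, then, for some $m\in I$, there exists a finitely generated (strongly) projective right $S_m$-semimodule $Q$ such that $Q \otimes_{S_m} S \cong P$. (2) If $P \otimes_{S_i} S \cong Q \otimes_{S_i} S$ for some $i\in I$ and finitely generated (strongly) projective right $S_i$-semimodules $P, Q$, then $P \otimes_{S_i} S_k \cong Q \otimes_{S_i} S_k$ for some $k \ge i$.
   Context: A semiring $(S,+,\cdot,0,1)$ consists of a commutative monoid $(S,+,0)$ and a monoid $(S,\cdot,1)$ such that multiplication distributes over addition on both sides and $0s=0=s0$; semiring homomorphisms preserve $+,\cdot,0,1$. A direct system of semirings over a directed set $I$ (a partially ordered set in which any two elements have an upper bound) is a family $(S_i)_{i\in I}$ of semirings with semiring homomorphisms $\varphi_{ij}\colon S_i\to S_j$ for $i\le j$ such that $\varphi_{jk}\varphi_{ij}=\varphi_{ik}$ and $\varphi_{ii}=\mathrm{id}$; its direct limit is the usual filtered colimit in the category of semirings, with canonical homomorphisms $\varphi_i\colon S_i\to S$. Right $S$-semimodules are commutative monoids with a unital, biadditive, associative right action of $S$ with $0_Ms=0_M=m0$; free semimodules are direct sums of copies of $S_S$; a semimodule is finitely generated if it is a homomorphic image of a free semimodule with finite basis set. A projective semimodule is a retract of a free semimodule. A right $S$-semimodule is (finitely generated) strongly projective if it is isomorphic to a direct summand of a (finitely generated) free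 right $S$-semimodule. The tensor product $A\otimes_R B$ of a right $R$-semimodule $A$ and a left $R$-semimodule $B$ is the quotient of the free commutative monoid on $A\times B$ by the congruence generated by the pairs $\langle(a_1+a_2,b),(a_1,b)+(a_2,b)\rangle$, $\langle(a,b_1+b_2),(a,b_1)+(a,b_2)\rangle$, $\langle(ar,b),(a,rb)\rangle$; here $S$ is an $S_i$-$S$-bisemimodule via $\varphi_i$ and $S_k$ is an $S_i$-$S_k$-bisemimodule via $\varphi_{ik}$. Isomorphisms in (1) and (2) are isomorphisms of right $S$- and right $S_k$-semimodules, respectively.
   Formalization: The tensor product's congruence also identifies (0,b) and (a,0) with the empty sum, since without these pairs the quotient is not a semimodule and (1) fails for P = 0; the directed set I is taken to be nonempty, since otherwise no m exists in (1). *)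

(* Defs.v *)
From HB Require Import structures.
From mathcomp Require Import all_boot all_order all_algebra generic_quotient.
From mathcomp Require Import finmap.
From mathcomp Require Import boolp.

Set Implicit Arguments.
Unset Strict Implicit.
Unset Printing Implicit Defensive.

Import Order.TTheory GRing.Theory.

Local Open Scope fset_scope.
Local Open Scope ring_scope.
Local Open Scope quotient_scope.

(* Semirings are [pzSemiRingType]s (the zero semiring is allowed), left
   S-semimodules are [lSemiModType S]; a right S-semimodule is a left
   semimodule over the converse semiring, so that m . s is written s *: m with
   s : S^c. *)
Notation rSemiModType S := (lSemiModType S^c).

(* Direct sum of X-many copies of V, as finitely supported functions. *)
Section DirectSum.
Variables (X : choiceType) (V : nmodType).

Definition dsum : Type := {fsfun X -> V with 0}.

HB.instance Definition _ := SubType.copy dsum {fsfun X -> V with 0}.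
HB.instance Definition _ := [Choice of dsum by <:].

Definition dsupp (u : dsum) : {fset X} := finsupp u.

Lemma dsumP (u v : dsum) : u =1 v -> u = v.
Proof. by move=> uv; apply/(@fsfunP X V (fun=> 0) u v). Qed.

Lemma mem_dsupp (u : dsum) x : (x \in dsupp u) = (u x != 0).
Proof. exact: mem_finsupp. Qed.

Lemma dsuppN (u : dsum) x : x \notin dsupp u -> u x = 0.
Proof. by rewrite mem_dsupp negbK => /eqP. Qed.

Definition dsum0 : dsum := [fsfun].
Definition dsum_add (u v : dsum) : dsum :=
  [fsfun x in dsupp u `|` dsupp v => u x + v x].
(* [v] at [x], and 0 elsewhere *)
Definition delta (x : X) (v : V) : dsum := [fsfun dsum0 with x |-> v].

Lemma dsum0E x : dsum0 x = 0.
Proof. exact: fsfun0E. Qed.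

Lemma dsum_addE u v x : dsum_add u v x = u x + v x.
Proof.
rewrite /dsum_add fsfun_fun inE; case: ifP => //.
by move/negbT; rewrite negb_or => /andP[/dsuppN-> /dsuppN->]; rewrite addr0.
Qed.

Lemma deltaE x v y : delta x v y = if y == x then v else 0.
Proof. by rewrite /delta fsfun_withE; case: ifP => // _; exact: fsfun0E. Qed.

Lemma dsum_addA : associative dsum_add.
Proof. by move=> u v w; apply: dsumP => x; rewrite !dsum_addE addrA. Qed.

Lemma dsum_addC : commutative dsum_add.
Proof. by move=> u v; apply: dsumP => x; rewrite !dsum_addE addrC. Qed.

Lemma dsum_add0 : left_id dsum0 dsum_add.
Proof. by move=> u; apply: dsumP => x; rewrite dsum_addE dsum0E add0r. Qed.

HB.instance Definition _ :=
  GRing.isNmodule.Build dsum dsum_addA dsum_addC dsum_add0.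

Lemma dsumD (u v : dsum) x : (u + v) x = u x + v x.
Proof. exact: dsum_addE. Qed.

Lemma dsum0x x : (0 : dsum) x = 0.
Proof. exact: dsum0E. Qed.

Lemma dsum_sum (I : Type) (r : seq I) (P : pred I) (F : I -> dsum) x :
  (\sum_(i <- r | P i) F i) x = \sum_(i <- r | P i) F i x.
Proof.
apply: (big_morph (fun u : dsum => u x)) => [u v|]; [exact: dsumD|exact: dsum0x].
Qed.

Lemma dsum_deltaE (u : dsum) : u = \sum_(x <- dsupp u) delta x (u x).
Proof.
apply: dsumP => y; rewrite dsum_sum.
have [yu|yu] := boolP (y \in dsupp u); last first.
  rewrite (dsuppN yu) big_seq big1 // => x xu; rewrite deltaE.
  by case: eqP => // yx; rewrite yx xu in yu.
rewrite (bigD1_seq y) //= deltaE eqxx big1 ?addr0 // => x.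
by rewrite deltaE eq_sym => /negPf->.
Qed.

Lemma delta_add x v w : delta x (v + w) = delta x v + delta x w.
Proof.
by apply: dsumP => y; rewrite dsumD !deltaE; case: ifP => // _; rewrite addr0.
Qed.

Lemma delta0 x : delta x 0 = 0.
Proof. by apply: dsumP => y; rewrite deltaE dsum0x if_same. Qed.

End DirectSum.

Section DirectSumSemimodule.
Variables (R : pzSemiRingType) (X : choiceType) (V : lSemiModType R).

Definition dsum_scale (a : R) (u : dsum X V) : dsum X V :=
  [fsfun x in dsupp u => a *: u x].

Lemma dsum_scaleE a u x : dsum_scale a u x = a *: u x.
Proof.
rewrite /dsum_scale fsfun_fun; case: ifP => // /negbT /dsuppN ux0.
by rewrite ux0 scaler0.
Qed.

Lemma dsum_scaleA a b u : dsum_scale a (dsum_scale b u) = dsum_scale (a * b) u.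
Proof. by apply: dsumP => x; rewrite !dsum_scaleE scalerA. Qed.

Lemma dsum_scale0 u : dsum_scale 0 u = 0.
Proof. by apply: dsumP => x; rewrite dsum_scaleE scale0r dsum0x. Qed.

Lemma dsum_scale1 : left_id 1 dsum_scale.
Proof. by move=> u; apply: dsumP => x; rewrite dsum_scaleE scale1r. Qed.

Lemma dsum_scaleDr : right_distributive dsum_scale +%R.
Proof. by move=> a u v; apply: dsumP => x; rewrite !(dsum_scaleE, dsumD) scalerDr. Qed.

Lemma dsum_scaleDl u : {morph dsum_scale^~ u : a b / a + b}.
Proof. by move=> a b; apply: dsumP => x; rewrite !(dsum_scaleE, dsumD) scalerDl. Qed.

HB.instance Definition _ := GRing.Nmodule_isLSemiModule.Build R (dsum X V)
  dsum_scaleA dsum_scale0 dsum_scale1 dsum_scaleDr dsum_scaleDl.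

Lemma dsumZ a (u : dsum X V) x : (a *: u) x = a *: u x.
Proof. exact: dsum_scaleE. Qed.

End DirectSumSemimodule.

(* The predicates below are stated over an arbitrary semiring R; for right
   S-semimodules they are used with R := S^c, and then R^o is S_S. *)
Section Semimodules.
Variable R : pzSemiRingType.

Definition free_semimod (X : choiceType) : lSemiModType R := dsum X R^o.

Definition isomorphic (M N : lSemiModType R) : Prop :=
  exists f : {linear M -> N}, bijective f.

Definition retract_of (M N : lSemiModType R) : Prop :=
  exists (i : {linear M -> N}) (r : {linear N -> M}), cancel i r.

Definition finitely_generated (M : lSemiModType R) : Prop :=
  exists (X : finType) (f : {linear free_semimod X -> M}),
    forall y, exists x, f x = y.

Definition projective (M : lSemiModType R) : Prop :=
  exists X : choiceType, retract_of M (free_semimod X).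

Definition iso_direct_summand (M F : lSemiModType R) : Prop :=
  exists N : lSemiModType R, isomorphic (M * N)%type F.

Definition fg_projective (M : lSemiModType R) : Prop :=
  finitely_generated M /\ projective M.

Definition fg_strongly_projective (M : lSemiModType R) : Prop :=
  exists X : choiceType,
    finitely_generated (free_semimod X) /\
    iso_direct_summand M (free_semimod X).

End Semimodules.

Definition free_cmon (X : choiceType) : nmodType := dsum X nat.
Definition gen (X : choiceType) (x : X) : free_cmon X := delta x 1%N.

Section FreeCommutativeMonoidMap.
Variables (X Y : choiceType) (f : X -> Y).

Definition free_cmon_map (u : free_cmon X) : free_cmon Y :=
  \sum_(x <- dsupp u) gen (f x) *+ u x.

Lemma free_cmon_map_fset (A : {fset X}) (u : free_cmon X) :
  dsupp u `<=` A -> free_cmon_map u = \sum_(x <- A) gen (f x) *+ u x.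
Proof.
move=> uA; rewrite /free_cmon_map; apply: big_fset_incl => // x _ /dsuppN->.
by rewrite mulr0n.
Qed.

Lemma free_cmon_map0 : free_cmon_map 0 = 0.
Proof. by rewrite /free_cmon_map big1 // => x _; rewrite dsum0x mulr0n. Qed.

Lemma free_cmon_mapD u v :
  free_cmon_map (u + v) = free_cmon_map u + free_cmon_map v.
Proof.
pose A := dsupp u `|` dsupp v.
have uvA : dsupp (u + v) `<=` A.
  apply/fsubsetP => x; rewrite inE !mem_dsupp dsumD; apply: contraNT.
  by rewrite negb_or !negbK => /andP[/eqP-> /eqP->].
rewrite !(@free_cmon_map_fset A) ?fsubsetUl ?fsubsetUr // -big_split /=.
by apply: eq_bigr => x _; rewrite dsumD mulrnDr.
Qed.

Lemma free_cmon_map_gen x : free_cmon_map (gen x) = gen (f x).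
Proof.
rewrite (@free_cmon_map_fset [fset x]).
  by rewrite big_seq_fset1 deltaE eqxx mulr1n.
by apply/fsubsetP => y; rewrite mem_dsupp deltaE inE; case: ifP; rewrite ?eqxx.
Qed.

End FreeCommutativeMonoidMap.

Lemma free_cmon_ind (X : choiceType) (P : free_cmon X -> Prop) :
  P 0 -> (forall x u, P u -> P (gen x + u)) -> forall u, P u.
Proof.
move=> P0 PS u; rewrite [u]dsum_deltaE.
elim: (enum_fset (dsupp u)) => [|x s IHs]; first by rewrite big_nil.
rewrite big_cons; elim: (u x) => [|n IHn]; first by rewrite delta0 add0r.
by rewrite (delta_add x (1%N : nat) n : delta x n.+1 = _) -addrA; apply: PS.
Qed.

Section Tensor.
Variables (R : pzSemiRingType) (A : rSemiModType R) (B : lSemiModType R).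

(* The congruence of free_cmon (A * B) generated by the biadditivity and
   balancing relations.  Biadditivity includes the nullary relations
   (0, b) = 0 and (a, 0) = 0: the binary ones never identify the empty sum with
   a nonempty one, and without the nullary ones the quotient would have a
   neutral element distinct from 0 (x) 0, and would not be a semimodule. *)
Inductive tensor_cong : free_cmon (A * B)%type -> free_cmon (A * B)%type -> Prop :=
| TensorRefl u : tensor_cong u u
| TensorSym u v : tensor_cong u v -> tensor_cong v u
| TensorTrans u v w : tensor_cong u v -> tensor_cong v w -> tensor_cong u w
| TensorAdd u u' v v' :
    tensor_cong u u' -> tensor_cong v v' -> tensor_cong (u + v) (u' + v')
| TensorDl a1 a2 b :
    tensor_cong (gen (a1 + a2, b)) (gen (a1, b) + gen (a2, b))
| TensorDr a b1 b2 :
    tensor_cong (gen (a, b1 + b2)) (gen (a, b1) + gen (a, b2))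
| Tensor0l b : tensor_cong (gen (0, b)) 0
| Tensor0r a : tensor_cong (gen (a, 0)) 0
| TensorBal a (r : R) b :
    tensor_cong (gen ((r : R^c) *: a, b)) (gen (a, r *: b)).

Definition tensor_rel : rel (free_cmon (A * B)%type) :=
  fun u v => `[< tensor_cong u v >].

Lemma tensor_rel_refl : reflexive tensor_rel.
Proof. by move=> u; apply/asboolP; apply: TensorRefl. Qed.

Lemma tensor_rel_sym : symmetric tensor_rel.
Proof.
by move=> u v; apply/asboolP/asboolP; apply: TensorSym.
Qed.

Lemma tensor_rel_trans : transitive tensor_rel.
Proof.
by move=> v u w /asboolP uv /asboolP vw; apply/asboolP; apply: TensorTrans vw.
Qed.

Canonical tensor_equiv :=
  EquivRel tensor_rel tensor_rel_refl tensor_rel_sym tensor_rel_trans.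

Definition tensor : Type := {eq_quot tensor_equiv}.
HB.instance Definition _ := Choice.copy tensor {eq_quot tensor_equiv}.

Definition tensor_class (u : free_cmon (A * B)%type) : tensor :=
  \pi_{eq_quot tensor_equiv} u.
Definition tensor_repr (t : tensor) : free_cmon (A * B)%type :=
  repr (t : {eq_quot tensor_equiv}).

Lemma tensor_reprK : cancel tensor_repr tensor_class.
Proof. exact: reprK. Qed.

Lemma tensor_classP u v : tensor_class u = tensor_class v <-> tensor_cong u v.
Proof.
split=> [/eqmodP /asboolP //|uv].
by apply/eqmodP/asboolP.
Qed.

Lemma tensor_repr_class u : tensor_cong (tensor_repr (tensor_class u)) u.
Proof. by apply/tensor_classP; rewrite tensor_reprK. Qed.

Definition tensor_add (s t : tensor) : tensor :=
  tensor_class (tensor_repr s + tensor_repr t).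

Lemma tensor_add_class u v :
  tensor_add (tensor_class u) (tensor_class v) = tensor_class (u + v).
Proof. by apply/tensor_classP/TensorAdd; apply: tensor_repr_class. Qed.

Lemma tensor_addA : associative tensor_add.
Proof.
move=> r s t; rewrite -[r]tensor_reprK -[s]tensor_reprK -[t]tensor_reprK.
by rewrite !tensor_add_class addrA.
Qed.

Lemma tensor_addC : commutative tensor_add.
Proof. by move=> s t; rewrite /tensor_add addrC. Qed.

Lemma tensor_add0 : left_id (tensor_class 0) tensor_add.
Proof. by move=> t; rewrite -[t]tensor_reprK tensor_add_class add0r. Qed.

HB.instance Definition _ :=
  GRing.isNmodule.Build tensor tensor_addA tensor_addC tensor_add0.

Lemma tensor_classD u v : tensor_class (u + v) = tensor_class u + tensor_class v.
Proof. by rewrite -tensor_add_class. Qed.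

Lemma tensor_class0 : tensor_class 0 = 0.
Proof. by []. Qed.

Definition tens (a : A) (b : B) : tensor := tensor_class (gen (a, b)).

Lemma tensDl a1 a2 b : tens (a1 + a2) b = tens a1 b + tens a2 b.
Proof. by rewrite -tensor_classD; apply/tensor_classP/TensorDl. Qed.

Lemma tensDr a b1 b2 : tens a (b1 + b2) = tens a b1 + tens a b2.
Proof. by rewrite -tensor_classD; apply/tensor_classP/TensorDr. Qed.

Lemma tens0l b : tens 0 b = 0.
Proof. by apply/tensor_classP/Tensor0l. Qed.

Lemma tens0r a : tens a 0 = 0.
Proof. by apply/tensor_classP/Tensor0r. Qed.

Lemma tensZ a (r : R) b : tens ((r : R^c) *: a) b = tens a (r *: b).
Proof. by apply/tensor_classP/TensorBal. Qed.

Lemma tensor_ind (P : tensor -> Prop) :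
  P 0 -> (forall a b t, P t -> P (tens a b + t)) -> forall t, P t.
Proof.
move=> P0 PS t; rewrite -[t]tensor_reprK.
elim/free_cmon_ind: (tensor_repr t) => [|[a b] u Pu]; first exact: P0.
by rewrite tensor_classD; apply: PS.
Qed.

End Tensor.

Section TensorMap.
Variables (R : pzSemiRingType) (A : rSemiModType R) (B B' : lSemiModType R).
Variable g : {linear B -> B'}.

(* id (x) g *)
Definition tensor_map (t : tensor A B) : tensor A B' :=
  tensor_class (free_cmon_map (fun x => (x.1, g x.2)) (tensor_repr t)).

Lemma tensor_map_class u :
  tensor_map (tensor_class u) =
  tensor_class (free_cmon_map (fun x => (x.1, g x.2)) u).
Proof.
apply/tensor_classP; move: (tensor_repr_class u); rewrite /=.
move: (tensor_repr _) => w; elim=> {u w}.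
- by move=> u; apply: TensorRefl.
- by move=> u v _; apply: TensorSym.
- by move=> u v w _ uv _; apply: TensorTrans.
- by move=> u u' v v' _ uu' _ vv'; rewrite !free_cmon_mapD; apply: TensorAdd.
- by move=> a1 a2 b; rewrite free_cmon_mapD !free_cmon_map_gen; apply: TensorDl.
- move=> a b1 b2; rewrite free_cmon_mapD !free_cmon_map_gen /= raddfD.
  exact: TensorDr.
- by move=> b; rewrite free_cmon_map_gen free_cmon_map0; apply: Tensor0l.
- move=> a; rewrite free_cmon_map_gen free_cmon_map0 /= raddf0.
  exact: Tensor0r.
- by move=> a r b; rewrite !free_cmon_map_gen /= linearZ; apply: TensorBal.
Qed.

Lemma tensor_map_tens a b : tensor_map (tens a b) = tens a (g b).
Proof. by rewrite tensor_map_class free_cmon_map_gen. Qed.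

Lemma tensor_map0 : tensor_map 0 = 0.
Proof. by rewrite tensor_map_class free_cmon_map0. Qed.

Lemma tensor_mapD s t : tensor_map (s + t) = tensor_map s + tensor_map t.
Proof.
rewrite -[s]tensor_reprK -[t]tensor_reprK -tensor_classD !tensor_map_class.
by rewrite free_cmon_mapD tensor_classD.
Qed.

End TensorMap.

(* S as a left R-semimodule through phi : r . s = phi r * s *)
Definition restr (R S : pzSemiRingType) (phi : {rmorphism R -> S}) : Type := S.

Section Restriction.
Variables (R S : pzSemiRingType) (phi : {rmorphism R -> S}).
Local Notation restr := (restr phi).

HB.instance Definition _ := GRing.Nmodule.copy restr S.

Definition restr_scale (r : R) (s : restr) : restr := phi r * (s : S).

Lemma restr_scaleA a b s :
  restr_scale a (restr_scale b s) = restr_scale (a * b) s.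
Proof. by rewrite /restr_scale rmorphM mulrA. Qed.
Lemma restr_scale0 s : restr_scale 0 s = 0.
Proof. by rewrite /restr_scale rmorph0 mul0r. Qed.
Lemma restr_scale1 : left_id 1 restr_scale.
Proof. by move=> s; rewrite /restr_scale rmorph1 mul1r. Qed.
Lemma restr_scaleDr : right_distributive restr_scale +%R.
Proof. by move=> r s t; rewrite /restr_scale mulrDr. Qed.
Lemma restr_scaleDl s : {morph restr_scale^~ s : a b / a + b}.
Proof. by move=> a b; rewrite /restr_scale rmorphD mulrDl. Qed.

HB.instance Definition _ := GRing.Nmodule_isLSemiModule.Build R restr
  restr_scaleA restr_scale0 restr_scale1 restr_scaleDr restr_scaleDl.

Definition restr_rmul (s : S) (x : restr) : restr := (x : S) * s.

Lemma restr_rmul_semilinear s : semilinear (restr_rmul s).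
Proof.
split=> [r x|x y]; first by rewrite /restr_rmul /GRing.scale /= /restr_scale mulrA.
by rewrite /restr_rmul mulrDl.
Qed.

HB.instance Definition _ s :=
  GRing.isSemilinear.Build R restr restr *:%R (restr_rmul s)
    (restr_rmul_semilinear s).

End Restriction.

(* A (x)_R S, where S is an R-S-bisemimodule through phi, as a right
   S-semimodule: (a (x) x) . s = a (x) (x * s) *)
Section BaseChange.
Variables (R S : pzSemiRingType) (A : rSemiModType R) (phi : {rmorphism R -> S}).

Definition base_change : Type := tensor A (restr phi).
HB.instance Definition _ := GRing.Nmodule.copy base_change (tensor A (restr phi)).

Definition base_change_scale (s : S^c) (t : base_change) : base_change :=
  tensor_map (@restr_rmul R S phi s) t.

Lemma base_change_scaleD s (t u : base_change) :
  base_change_scale s (t + u) = base_change_scale s t + base_change_scale s u.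
Proof. exact: tensor_mapD. Qed.

Lemma base_change_scale_0 s : base_change_scale s 0 = 0.
Proof. exact: tensor_map0. Qed.

Lemma base_change_scale_tens (s : S^c) a (x : S) :
  base_change_scale s (tens a (x : restr phi)) = tens a (x * s : restr phi).
Proof. exact: tensor_map_tens. Qed.

Lemma base_change_scaleA s s' (t : base_change) :
  base_change_scale s (base_change_scale s' t) = base_change_scale (s * s') t.
Proof.
elim/tensor_ind: t => [|a x t IHt]; first by rewrite !base_change_scale_0.
by rewrite !base_change_scaleD IHt !base_change_scale_tens mulrA.
Qed.

Lemma base_change_scale0 (t : base_change) : base_change_scale 0 t = 0.
Proof.
elim/tensor_ind: t => [|a x t IHt]; first by rewrite !base_change_scale_0.
rewrite base_change_scaleD IHt base_change_scale_tens addr0.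
by rewrite (_ : (x : S) * 0 = 0) ?mulr0 // tens0r.
Qed.

Lemma base_change_scale1 : left_id 1 base_change_scale.
Proof.
move=> t; elim/tensor_ind: t => [|a x t IHt]; first by rewrite !base_change_scale_0.
rewrite base_change_scaleD IHt base_change_scale_tens.
by rewrite (_ : (x : S) * 1 = x) ?mulr1.
Qed.

Lemma base_change_scaleDl (t : base_change) :
  {morph base_change_scale^~ t : s s' / s + s'}.
Proof.
move=> s s'; elim/tensor_ind: t => [|a x t IHt].
  by rewrite !base_change_scale_0 addr0.
rewrite !base_change_scaleD IHt !base_change_scale_tens.
by rewrite (_ : (x : S) * (s + s') = (x * s) + (x * s')) ?mulrDr // tensDr addrACA.
Qed.

HB.instance Definition _ := GRing.Nmodule_isLSemiModule.Build S^c base_change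
  base_change_scaleA base_change_scale0 base_change_scale1 base_change_scaleD
  base_change_scaleDl.

Lemma base_changeZ_tens (s : S^c) a (x : S) :
  s *: (tens a (x : restr phi) : base_change) = tens a (x * s : restr phi).
Proof. exact: base_change_scale_tens. Qed.

End BaseChange.

Section DirectLimit.
Variables (d : Order.disp_t) (I : porderType d).

Definition directed : Prop :=
  inhabited I /\ forall i j : I, exists k : I, (i <= k)%O /\ (j <= k)%O.

Record direct_system := DirectSystem {
  ds_obj :> I -> pzSemiRingType;
  ds_map : forall i j : I, (i <= j)%O -> {rmorphism ds_obj i -> ds_obj j};
  ds_map_id : forall (i : I) (le_ii : (i <= i)%O) x, ds_map le_ii x = x;
  ds_map_comp : forall (i j k : I)
    (le_ij : (i <= j)%O) (le_jk : (j <= k)%O) (le_ik : (i <= k)%O) x,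
    ds_map le_jk (ds_map le_ij x) = ds_map le_ik x
}.

Variable D : direct_system.

Definition cocone (T : pzSemiRingType) (psi : forall i, {rmorphism D i -> T}) :=
  forall (i j : I) (le_ij : (i <= j)%O) x, psi j (ds_map D le_ij x) = psi i x.

Definition is_direct_limit (S : pzSemiRingType)
    (phi : forall i, {rmorphism D i -> S}) : Prop :=
  cocone phi /\
  forall (T : pzSemiRingType) (psi : forall i, {rmorphism D i -> T}),
    cocone psi ->
    exists u : {rmorphism S -> T},
      (forall i x, u (phi i x) = psi i x) /\
      (forall u' : {rmorphism S -> T},
         (forall i x, u' (phi i x) = psi i x) -> u' =1 u).

End DirectLimit.

(* Main.v *)
Require Import Defs.
From HB Require Import structures.
From mathcomp Require Import all_boot all_order all_algebra.
From mathcomp Require Import generic_quotient finmap boolp.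

Set Implicit Arguments.
Unset Strict Implicit.
Unset Printing Implicit Defensive.

Import Order.TTheory GRing.Theory.

Local Open Scope ring_scope.
Local Open Scope quotient_scope.

(* A finitely generated projective semimodule P is a retract of R^n, hence is
   determined up to isomorphism by the idempotent matrix E of the composite
   R^n -> P -> R^n; it is strongly projective when E has a complementary
   idempotent F, with E + F = 1 and EF = FE = 0.  The retracts with matrices E
   and F are isomorphic iff E = aFb and F = bEa for some a and b, and base
   change along phi replaces E by phi(E).  All these are finitely many
   equations between finitely many scalars, and a direct limit lifts both the
   scalars and the equations to some stage.  The latter is a fact about the
   concrete model of the limit (germs of elements of the D i); comparing the
   model with S only needs the universal property. *)

(** * Linear maps out of semimodules of row vectors *)

Section LinearMaps.
Variable R : pzSemiRingType.

(** Bundles a function that is local to a proof, where no instance can be declared. *)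
Definition linear_pack (U V : lSemiModType R) (f : U -> V)
    (f_lin : semilinear f) : {linear U -> V} :=
  HB.pack f (GRing.isSemilinear.Build R U V _ f f_lin).

Lemma isomorphicI (U V : lSemiModType R) (f : U -> V) (g : V -> U) :
  semilinear f -> cancel f g -> cancel g f -> isomorphic U V.
Proof. by move=> f_lin fK gK; exists (linear_pack f_lin); exists g. Qed.

Lemma semilinear_sum_scale n (V : lSemiModType R) (w : 'I_n -> V) :
  semilinear (fun v : 'rV[R]_n => \sum_j v 0 j *: w j).
Proof.
split=> [a v|u v].
  by rewrite scaler_sumr; apply: eq_bigr => j _; rewrite mxE scalerA.
by rewrite -big_split; apply: eq_bigr => j _; rewrite mxE scalerDl.
Qed.

Lemma linear_rV_sum n (V : lSemiModType R) (f : {linear 'rV[R]_n -> V}) v :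
  f v = \sum_j v 0 j *: f (delta_mx 0 j).
Proof.
rewrite {1}[v]matrix_sum_delta big_ord1 linear_sum.
by apply: eq_bigr => j _; rewrite linearZ.
Qed.

End LinearMaps.

(** * Coordinates on a free semimodule along a finite list of basis elements *)

Section FreeCoordinates.
Variables (R : pzSemiRingType) (X : choiceType) (n : nat) (t : n.-tuple X).

(** [t] may list only part of the basis: [coords] forgets the other coordinates, so it inverts
    [of_coords] on one side, and on the other side only for elements supported in [t]. *)
Definition coords (u : free_semimod R X) : 'rV[R]_n := \row_j u (tnth t j).

Definition of_coords (v : 'rV[R]_n) : free_semimod R X :=
  \sum_j v 0 j *: (delta (tnth t j) (1 : R^o) : free_semimod R X).

Lemma coords_semilinear : semilinear coords.
Proof.
by split=> [a u|u v]; apply/rowP=> j; rewrite !mxE ?dsumZ ?dsumD.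
Qed.

HB.instance Definition _ :=
  GRing.isSemilinear.Build R (free_semimod R X) 'rV[R]_n _ coords
    coords_semilinear.

HB.instance Definition _ :=
  GRing.isSemilinear.Build R 'rV[R]_n (free_semimod R X) _ of_coords
    (semilinear_sum_scale _).

Lemma of_coordsE v x : of_coords v x = \sum_(j | tnth t j == x) v 0 j.
Proof.
rewrite dsum_sum [RHS]big_mkcond; apply: eq_bigr => j _.
rewrite dsumZ deltaE eq_sym; case: ifP => _; last exact: scaler0.
exact: mulr1.
Qed.

Lemma of_coordsK : uniq t -> cancel of_coords coords.
Proof.
move=> /uniqP t_inj v; apply/rowP=> j; rewrite mxE of_coordsE.
rewrite (big_pred1 j) // => k; apply/eqP/eqP => [|->//].
(* [nth] needs a default, and [X] may be empty; the index [j] provides an element. *)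
have x0 : X := tnth t j.
rewrite !(tnth_nth x0) => /(t_inj x0); rewrite !inE !size_tuple.
by move=> /(_ (ltn_ord _) (ltn_ord _))/val_inj.
Qed.

Lemma coordsK (u : free_semimod R X) :
  uniq t -> {subset dsupp u <= t} -> of_coords (coords u) = u.
Proof.
move=> t_uniq ut; apply: dsumP => x; rewrite of_coordsE.
under eq_bigr => j /eqP jx do rewrite mxE jx.
have [/tnthP[j ->]|xt] := boolP (x \in t).
  rewrite (big_pred1 j) // => k /=.
  by rewrite (inj_eq _) //; apply/tuple_uniqP.
have ux : u x = 0 by apply: dsuppN; apply: contraNN xt => /ut.
by rewrite big1.
Qed.

End FreeCoordinates.

(** * Retracts of R^n and their idempotent matrices *)

Section MatrixRetracts.
Variable R : pzSemiRingType.

(* Matrices act on row vectors from the right, so that composites of linear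
   maps correspond to matrix products in the reverse order.  For right
   S-semimodules, R is S^c. *)
Definition mx_retract n (E : 'M[R]_n) (M : lSemiModType R) : Prop :=
  exists (i : {linear M -> 'rV[R]_n}) (r : {linear 'rV[R]_n -> M}),
    cancel i r /\ forall v, i (r v) = v *m E.

Lemma retract_mx n (M : lSemiModType R) (i : {linear M -> 'rV[R]_n})
    (r : {linear 'rV[R]_n -> M}) :
  cancel i r -> mx_retract (lin1_mx (i \o r)) M.
Proof. by move=> iK; exists i, r; split=> // v; rewrite mul_rV_lin1. Qed.

Lemma rV_mulmx_inj m n (A B : 'M[R]_(m, n)) :
  (forall v : 'rV_m, v *m A = v *m B) -> A = B.
Proof. by move=> AB; apply/row_matrixP => j; rewrite !rowE AB. Qed.

Lemma mx_retract_idem n (E : 'M[R]_n) M : mx_retract E M -> E *m E = E.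
Proof.
move=> [i [r [iK ir]]]; apply: rV_mulmx_inj => v.
by rewrite mulmxA -!ir iK.
Qed.

(** The isomorphism applies [i], then [a], then [s]. Since j(s v) = vF, going there and back gives
    r(i x aFb) = r(i x E) = r(i(r(i x))) = x. *)
Lemma mx_retract_iso m n (E : 'M[R]_m) (F : 'M[R]_n) M N
    (a : 'M[R]_(m, n)) (b : 'M[R]_(n, m)) :
  mx_retract E M -> mx_retract F N ->
  a *m F *m b = E -> b *m E *m a = F -> isomorphic M N.
Proof.
move=> Mr Nr aFb bEa.
have EE := mx_retract_idem Mr; have FF := mx_retract_idem Nr.
case: Mr => i [r [iK ir]]; case: Nr => j [s [jK js]].
apply: (@isomorphicI _ _ _ (fun x => s (i x *m a)) (fun y => r (j y *m b))).
- split=> [c x|x y]; first by rewrite linearZ -scalemxAl linearZ.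
  by rewrite raddfD mulmxDl raddfD.
- by move=> x; rewrite js -2!mulmxA [a *m _]mulmxA aFb -ir !iK.
- by move=> y; rewrite ir -2!mulmxA [b *m _]mulmxA bEa -js !jK.
Qed.

Lemma mx_retract_isoE m n (E : 'M[R]_m) (F : 'M[R]_n) M N :
  mx_retract E M -> mx_retract F N -> isomorphic M N ->
  exists (a : 'M[R]_(m, n)) (b : 'M[R]_(n, m)),
    a *m F *m b = E /\ b *m E *m a = F.
Proof.
move=> [i [r [iK ir]]] [j [s [jK js]]] [f [g fK gK]].
have g_lin : semilinear g := can2_semilinear fK gK.
pose g' := linear_pack g_lin.
(* The isomorphism and its inverse, carried to row vectors along the retractions and sections. *)
exists (lin1_mx (j \o f \o r)), (lin1_mx (i \o g' \o s)).
split; apply: rV_mulmx_inj => v; rewrite !mulmxA !mul_rV_lin1 /=.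
  by rewrite -js -ir jK jK fK.
by rewrite -ir -js iK iK gK.
Qed.

(* Taken at g = id, this makes X essentially finite when the free semimodule on
   X is finitely generated; over the zero semiring A may be empty. *)
Lemma fg_supports_bounded (M : lSemiModType R) (X : choiceType)
    (g : {linear M -> free_semimod R X}) :
  finitely_generated M ->
  exists A : {fset X}, forall x, {subset dsupp (g x) <= A}.
Proof.
move=> [Y [f f_surj]]; pose w y := g (f (delta y (1 : R^o))).
exists (\bigcup_(y <- enum Y) dsupp (w y))%fset => x; have [u <-] := f_surj x.
move=> z; apply: contraTT => zA; rewrite mem_dsupp negbK.
have wz y : w y z = 0.
  apply: dsuppN; apply: contraNN zA => zy.
  by apply/bigfcupP; exists y; rewrite ?mem_enum.
rewrite [u]dsum_deltaE !linear_sum dsum_sum big1 // => y _.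
suff -> : delta y (u y) = u y *: (delta y (1 : R^o) : free_semimod R Y).
  by rewrite !linearZ dsumZ wz scaler0.
apply: dsumP => t; rewrite dsumZ !deltaE.
by case: ifP; rewrite ?scaler0 // => _; rewrite /GRing.scale /= mulr1.
Qed.

(** Only finitely many basis elements occur in the image of [g]; [c] reads the coordinates along
    them and [d] rebuilds the element. *)
Lemma fg_free_rV (X : choiceType) (M : lSemiModType R)
    (g : {linear M -> free_semimod R X}) :
  finitely_generated M ->
  exists (n : nat) (c : {linear free_semimod R X -> 'rV[R]_n})
         (d : {linear 'rV[R]_n -> free_semimod R X}),
    cancel d c /\ forall x, d (c (g x)) = g x.
Proof.
move=> /(fg_supports_bounded g)[A gA]; pose t := in_tuple (enum_fset A).
have t_uniq : uniq t by exact: fset_uniq.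
exists _, (coords t : {linear _ -> _}), (of_coords t : {linear _ -> _}).
by split=> [|x]; [exact: of_coordsK | rewrite /= coordsK // => y /gA].
Qed.

(** The basis [X] given by projectivity may be infinite; finite generation of [M] bounds the
    supports of its image, which cuts the free semimodule down to R^n. *)
Lemma fg_projective_mx (M : lSemiModType R) :
  fg_projective M -> exists n (E : 'M[R]_n), mx_retract E M.
Proof.
move=> [M_fg [X [i [r iK]]]]; have [n [c [d [_ cgK]]]] := fg_free_rV i M_fg.
have ciK : cancel (c \o i) (r \o d) by move=> x /=; rewrite cgK iK.
by exists n, (lin1_mx ((c \o i) \o (r \o d))); exact: retract_mx.
Qed.

Lemma mx_fg_projective n (E : 'M[R]_n) (M : lSemiModType R) :
  mx_retract E M -> fg_projective M.
Proof.
pose t := ord_tuple n; have t_uniq : uniq t by exact: enum_uniq.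
have tT (u : free_semimod R 'I_n) : {subset dsupp u <= t}.
  by move=> x _; exact: mem_enum.
move=> [i [r [iK _]]]; split.
  exists 'I_n, (r \o coords t : {linear _ -> _}) => x.
  by exists (of_coords t (i x)); rewrite /= of_coordsK.
exists 'I_n, (of_coords t \o i : {linear _ -> _}),
  (r \o coords t : {linear _ -> _}) => x.
by rewrite /= of_coordsK.
Qed.

End MatrixRetracts.

(** * The retract cut out by an idempotent matrix *)

Section FixedRows.
Variables (R : pzSemiRingType) (n : nat) (E : 'M[R]_n).

(** For idempotent [E] the fixed rows are exactly the image of [E]; being fixed is a linear
    equation, so closure under the operations is immediate. *)
Definition fixed_row : pred 'rV[R]_n := fun v => v *m E == v.

Lemma fixed_row_closed : subsemimod_closed fixed_row.
Proof.
split=> [|a v /eqP vE]; last by rewrite unfold_in -scalemxAl vE.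
split=> [|u v /eqP uE /eqP vE]; first by rewrite unfold_in mul0mx.
by rewrite unfold_in mulmxDl uE vE.
Qed.

Definition fixed_rows : Type := {v : 'rV[R]_n | fixed_row v}.
HB.instance Definition _ := SubType.on fixed_rows.
HB.instance Definition _ := [Choice of fixed_rows by <:].
HB.instance Definition _ := GRing.SubChoice_isSubLSemiModule.Build R
  'rV[R]_n fixed_row fixed_rows fixed_row_closed.

Definition fixed_val (x : fixed_rows) : 'rV[R]_n := val x.

Lemma fixed_val_semilinear : semilinear fixed_val.
Proof. by split=> [a x|x y]; [exact: linearZ | exact: raddfD]. Qed.

HB.instance Definition _ := GRing.isSemilinear.Build R fixed_rows 'rV[R]_n _
  fixed_val fixed_val_semilinear.

Lemma fixed_val_inj : injective fixed_val.
Proof. exact: val_inj. Qed.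

Lemma fixed_valP x : fixed_val x *m E = fixed_val x.
Proof. exact/eqP/(valP x). Qed.

Hypothesis E_idem : E *m E = E.

Fact fixed_row_mul (v : 'rV[R]_n) : fixed_row (v *m E).
Proof. by rewrite /fixed_row -mulmxA E_idem. Qed.

Definition fixed_proj (v : 'rV[R]_n) : fixed_rows :=
  Sub (v *m E) (fixed_row_mul v).

Lemma fixed_projE v : fixed_val (fixed_proj v) = v *m E.
Proof. by []. Qed.

Lemma fixed_proj_semilinear : semilinear fixed_proj.
Proof.
split=> [a v|u v]; apply: fixed_val_inj.
  by rewrite linearZ /= !fixed_projE scalemxAl.
by rewrite raddfD /= !fixed_projE mulmxDl.
Qed.

Lemma fixed_rows_retract : mx_retract E fixed_rows.
Proof.
exists (fixed_val : {linear _ -> _}), (linear_pack fixed_proj_semilinear).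
split=> // x; apply: fixed_val_inj.
exact: fixed_valP.
Qed.

End FixedRows.

(** * Complementary idempotents and strong projectivity *)

Section StronglyProjective.
Variable R : pzSemiRingType.

(** Without subtraction, 1 - E has to be given as a second matrix [F]. Idempotency follows: E = E(E
    + F) = EE. *)
Definition complementary n (E F : 'M[R]_n) : Prop :=
  [/\ E + F = 1%:M, E *m F = 0 & F *m E = 0].

Lemma complementaryC n (E F : 'M[R]_n) : complementary E F -> complementary F E.
Proof. by move=> [EF1 EF0 FE0]; split; rewrite // addrC. Qed.

Lemma complementary_idem n (E F : 'M[R]_n) : complementary E F -> E *m E = E.
Proof.
by move=> [EF1 EF0 _]; rewrite -[RHS]mulmx1 -EF1 mulmxDr EF0 addr0.
Qed.

(** [E] and [F] are the matrices of the projections of R^n onto the two summands; they add up to the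
    identity because (x, y) = (x, 0) + (0, y). *)
Lemma fg_strongly_projective_mx (M : lSemiModType R) :
  fg_strongly_projective M ->
  exists n (E F : 'M[R]_n), complementary E F /\ mx_retract E M.
Proof.
move=> [X [X_fg [N [f [g fK gK]]]]].
(* Applied to the identity, this makes [c] and [d] inverse isomorphisms between the free semimodule
   and R^n. *)
have [n [c [d [dK cK]]]] := fg_free_rV (idfun : {linear _ -> _}) X_fg.
have g_lin : semilinear g := can2_semilinear fK gK.
have inl_lin : semilinear (fun x : M => (x, 0 : N)).
  by split=> [a x|x y]; apply: injective_projections;
    rewrite /= ?scaler0 ?addr0.
have inr_lin : semilinear (fun y : N => (0 : M, y)).
  by split=> [a x|x y]; apply: injective_projections;
    rewrite /= ?scaler0 ?addr0.
pose i := c \o f \o linear_pack inl_lin.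
pose j := c \o f \o linear_pack inr_lin.
pose r := fst \o linear_pack g_lin \o d.
pose s := snd \o linear_pack g_lin \o d.
have iK : cancel i r by move=> x; rewrite /r /i /= cK fK.
exists n, (lin1_mx (i \o r)), (lin1_mx (j \o s)); split; last exact: retract_mx.
split; apply: rV_mulmx_inj => v; rewrite ?mulmxDr ?mulmxA !mul_rV_lin1;
  rewrite ?mulmx0 ?mulmx1 /=.
- rewrite -!raddfD /=.
  have -> : ((g (d v)).1, 0) + (0, (g (d v)).2) = g (d v).
    by apply: injective_projections; rewrite /= ?addr0 ?add0r.
  by rewrite gK dK.
- by rewrite cK fK /= -[(0, 0)]/(0 : M * N)%type !raddf0.
- by rewrite cK fK /= -[(0, 0)]/(0 : M * N)%type !raddf0.
Qed.

(** Each row splits as v = vE + vF, and a row x fixed by [E] has xF = xEF = 0; so R^n is the direct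
    sum of the rows fixed by [E] and those fixed by [F]. *)
Lemma fixed_rows_strongly_projective n (E F : 'M[R]_n) :
  complementary E F -> fg_strongly_projective (fixed_rows E).
Proof.
move=> EF; have EE := complementary_idem EF.
have FF := complementary_idem (complementaryC EF).
have [EF1 EF0 FE0] := EF.
pose t := ord_tuple n; have t_uniq : uniq t by exact: enum_uniq.
exists 'I_n; split; first by exists 'I_n, idfun => x; exists x.
exists (fixed_rows F).
apply: (@isomorphicI _ _ _
   (fun x => of_coords t (fixed_val x.1 + fixed_val x.2))
   (fun u => (fixed_proj EE (coords t u), fixed_proj FF (coords t u)))).
- by split=> [a x|x y]; rewrite -?linearZ -?raddfD //= ?scalerDr // addrACA.
- move=> [x y]; rewrite /= of_coordsK //.
  have xF : fixed_val x *m F = 0 by rewrite -(fixed_valP x) -mulmxA EF0 mulmx0.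
  have yE : fixed_val y *m E = 0 by rewrite -(fixed_valP y) -mulmxA FE0 mulmx0.
  by congr (_, _); apply: fixed_val_inj;
    rewrite fixed_projE mulmxDl ?xF ?yE fixed_valP ?addr0 ?add0r.
- move=> u; rewrite /= !fixed_projE -mulmxDr EF1 mulmx1 coordsK // => x _.
  exact: mem_enum.
Qed.

End StronglyProjective.

(** * Universal properties of the free commutative monoid and of the tensor product *)

Section FreeCommutativeMonoidLift.
Variables (X : choiceType) (N : nmodType) (f : X -> N).

Definition free_cmon_lift (u : free_cmon X) : N :=
  \sum_(x <- dsupp u) f x *+ u x.

(** Terms outside the support vanish, so the sum can run over any larger finite set; additivity is
    then checked over one common set. *)
Lemma free_cmon_lift_fset (A : {fset X}) (u : free_cmon X) :
  (dsupp u `<=` A)%fset -> free_cmon_lift u = \sum_(x <- A) f x *+ u x.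
Proof.
move=> uA; rewrite /free_cmon_lift; apply: big_fset_incl => // x _ /dsuppN->.
by rewrite mulr0n.
Qed.

Lemma free_cmon_lift0 : free_cmon_lift 0 = 0.
Proof. by rewrite /free_cmon_lift big1 // => x _; rewrite dsum0x mulr0n. Qed.

Lemma free_cmon_liftD u v :
  free_cmon_lift (u + v) = free_cmon_lift u + free_cmon_lift v.
Proof.
pose A := (dsupp u `|` dsupp v)%fset.
have uvA : (dsupp (u + v)%R `<=` A)%fset.
  apply/fsubsetP => x; rewrite inE !mem_dsupp dsumD; apply: contraNT.
  by rewrite negb_or !negbK => /andP[/eqP-> /eqP->].
rewrite !(@free_cmon_lift_fset A) ?fsubsetUl ?fsubsetUr // -big_split /=.
by apply: eq_bigr => x _; rewrite dsumD mulrnDr.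
Qed.

Lemma free_cmon_lift_gen x : free_cmon_lift (gen x) = f x.
Proof.
rewrite (@free_cmon_lift_fset [fset x]%fset).
  by rewrite big_seq_fset1 deltaE eqxx mulr1n.
by apply/fsubsetP => y; rewrite mem_dsupp deltaE inE; case: ifP; rewrite ?eqxx.
Qed.

End FreeCommutativeMonoidLift.

Section TensorLift.
Variables (R : pzSemiRingType) (A : rSemiModType R) (B : lSemiModType R).
Variables (N : nmodType) (beta : A -> B -> N).
Hypothesis betaDl : forall a1 a2 b, beta (a1 + a2) b = beta a1 b + beta a2 b.
Hypothesis betaDr : forall a b1 b2, beta a (b1 + b2) = beta a b1 + beta a b2.
Hypothesis beta0l : forall b, beta 0 b = 0.
Hypothesis beta0r : forall a, beta a 0 = 0.
Hypothesis betaZ : forall a (r : R) b,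
  beta ((r : R^c) *: a) b = beta a (r *: b).

Definition tensor_lift (t : tensor A B) : N :=
  free_cmon_lift (fun x => beta x.1 x.2) (tensor_repr t).

(** Independence of the representative, by induction on the derivation of the congruence: each
    generating relation is matched by one hypothesis on [beta]. *)
Lemma tensor_lift_class u :
  tensor_lift (tensor_class u) = free_cmon_lift (fun x => beta x.1 x.2) u.
Proof.
rewrite /tensor_lift; move: (tensor_repr_class u).
move: (tensor_repr _) => w; elim=> {u w} //.
- by move=> u v w _ -> _ ->.
- by move=> u u' v v' _ uu' _ vv'; rewrite !free_cmon_liftD uu' vv'.
- by move=> a1 a2 b; rewrite free_cmon_liftD !free_cmon_lift_gen betaDl.
- by move=> a b1 b2; rewrite free_cmon_liftD !free_cmon_lift_gen betaDr.
- by move=> b; rewrite free_cmon_lift_gen free_cmon_lift0 beta0l.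
- by move=> a; rewrite free_cmon_lift_gen free_cmon_lift0 beta0r.
- by move=> a r b; rewrite !free_cmon_lift_gen betaZ.
Qed.

Lemma tensor_lift_tens a b : tensor_lift (tens a b) = beta a b.
Proof. by rewrite tensor_lift_class free_cmon_lift_gen. Qed.

Lemma tensor_lift0 : tensor_lift 0 = 0.
Proof. by rewrite tensor_lift_class free_cmon_lift0. Qed.

Lemma tensor_liftD s t : tensor_lift (s + t) = tensor_lift s + tensor_lift t.
Proof.
rewrite -[s]tensor_reprK -[t]tensor_reprK -tensor_classD !tensor_lift_class.
by rewrite free_cmon_liftD.
Qed.

End TensorLift.

(** Right semimodules have their coordinates in the converse semirings; a separate name for the same
    function carries the morphism instances there. *)
Definition convr_morph (R S : pzSemiRingType) (phi : R -> S) :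
  R^c -> S^c := phi.

(** * Base change of retracts *)

Section BaseChangeRetract.
Variables (R S : pzSemiRingType) (phi : {rmorphism R -> S}).

Fact convr_morph_nmod : nmod_morphism (convr_morph phi).
Proof. by split=> [|x y]; [exact: (rmorph0 phi) | exact: (rmorphD phi)]. Qed.

Fact convr_morph_monoid : monoid_morphism (convr_morph phi).
Proof. by split=> [|x y]; [exact: (rmorph1 phi) | exact: (rmorphM phi)]. Qed.

HB.instance Definition _ := GRing.isNmodMorphism.Build R^c S^c
  (convr_morph phi) convr_morph_nmod.
HB.instance Definition _ := GRing.isMonoidMorphism.Build R^c S^c
  (convr_morph phi) convr_morph_monoid.

(** Tensor induction restated on [base_change], the type that carries the action of S^c. *)
Lemma base_change_ind (M : rSemiModType R) (P : base_change M phi -> Prop) :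
  P 0 ->
  (forall a (x : restr phi) t, P t -> P ((tens a x : base_change M phi) + t)) ->
  forall t, P t.
Proof. exact: tensor_ind. Qed.

(* The retraction is m (x) s |-> phi(i m) s on S^n, with section
   v |-> \sum_j r(e_j) (x) v_j. *)
Lemma mx_retract_base_change n (E : 'M[R^c]_n) (M : rSemiModType R) :
  mx_retract E M ->
  mx_retract (map_mx (convr_morph phi) E) (base_change M phi).
Proof.
move=> [i [r [iK ir]]].
(* Scaling in S^c multiplies the entries of phi(i a) by x on the right in [S]. *)
pose beta (a : M) (x : restr phi) : 'rV[S^c]_n :=
  (x : S^c) *: map_mx (convr_morph phi) (i a).
pose i' (t : base_change M phi) := tensor_lift beta t.
pose r' (v : 'rV[S^c]_n) : base_change M phi :=
  \sum_j v 0 j *: (tens (r (delta_mx 0 j)) (1 : restr phi) : base_change M phi).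
have betaDl a1 a2 b : beta (a1 + a2) b = beta a1 b + beta a2 b.
  by rewrite /beta raddfD raddfD scalerDr.
have betaDr a b1 b2 : beta a (b1 + b2) = beta a b1 + beta a b2.
  exact: scalerDl.
have beta0l b : beta 0 b = 0 by rewrite /beta !raddf0.
have beta0r a : beta a 0 = 0 by exact: scale0r.
have betaZ a (c : R) b : beta ((c : R^c) *: a) b = beta a (c *: b).
  by rewrite /beta linearZ map_mxZ scalerA.
have i'_tens a x : i' (tens a x) = beta a x by exact: tensor_lift_tens.
have i'D (s t : base_change M phi) : i' (s + t) = i' s + i' t.
  exact: tensor_liftD.
have i'0 : i' (0 : base_change M phi) = 0 by exact: tensor_lift0.
have i'Z (s : S^c) t : i' (s *: t) = s *: i' t.
  elim/base_change_ind: t => [|a x t IHt]; first by rewrite scaler0 i'0 scaler0.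
  rewrite scalerDr !i'D scalerDr IHt base_changeZ_tens !i'_tens.
  by rewrite /beta scalerA.
have r'Z : semilinear r' by exact: semilinear_sum_scale.
have i'Z' : semilinear i' by [].
exists (linear_pack i'Z'), (linear_pack r'Z); split=> [t|v] /=.
  have r'D : {morph r' : u v / u + v} by case: r'Z.
  elim/base_change_ind: t => [|a x t IHt].
    by rewrite i'0; exact: (raddf0 (linear_pack r'Z)).
  rewrite i'D r'D IHt i'_tens; congr (_ + _).
  (* Writing a = r(i a) as a combination of the r(e_j) lets the coefficients (i a)_j cross the
     tensor sign, where they act through [phi]. *)
  rewrite -[a in RHS]iK linear_rV_sum /r' /beta.
  rewrite (big_morph (fun y => tens y x) (fun y z => tensDl y z x)
    (tens0l _ x)).
  apply: eq_bigr => j _; rewrite base_changeZ_tens tensZ !mxE; congr tens.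
  by rewrite /= mul1r.
have i'_sum := big_morph i' i'D i'0.
rewrite i'_sum mulmx_sum_row; apply: eq_bigr => j _.
by rewrite i'Z i'_tens /beta ir -rowE scale1r map_row.
Qed.

(** Both sides are retracts with the same matrix E' = phi(E), and a = b = E' satisfies the two
    equations because E' is idempotent. *)
Lemma base_change_fixed_rows_iso n (E : 'M[R^c]_n) (P : rSemiModType S) :
  E *m E = E -> mx_retract (map_mx (convr_morph phi) E) P ->
  isomorphic (base_change (fixed_rows E) phi) P.
Proof.
move=> EE; set E' := map_mx _ E => PE; have EE' := mx_retract_idem PE.
have QE := mx_retract_base_change (fixed_rows_retract EE).
by apply: (mx_retract_iso (a := E') (b := E') QE PE); rewrite !EE'.
Qed.

End BaseChangeRetract.

(** Induction on an enumeration of [F]; the empty family is bounded because [I] is inhabited. *)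
Lemma directed_fin_ub (d : Order.disp_t) (I : porderType d) (F : finType)
    (f : F -> I) :
  directed I -> exists k, forall x, (f x <= k)%O.
Proof.
move=> [[i0] ub]; suff [k fk] : exists k,
    forall x, x \in enum F -> (f x <= k)%O.
  by exists k => x; apply: fk; rewrite mem_enum.
elim: (enum F) => [|y s [k sk]]; first by exists i0.
have [l [yl kl]] := ub (f y) k; exists l => x; rewrite inE => /predU1P[->//|xs].
exact: le_trans (sk x xs) kl.
Qed.

(** * The direct limit as a semiring of germs *)

Section Germs.
Variables (d : Order.disp_t) (I : porderType d) (I_directed : directed I).
Variable D : direct_system I.

(** The boolean conjunction allows [germ_op] to extract a bound with [xchoose]. *)
Let ub (i j : I) : exists k : I, (i <= k)%O && (j <= k)%O.
Proof. by have [k [ik jk]] := I_directed.2 i j; exists k; rewrite ik. Qed.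

Definition stage_elt : Type := {i : I & D i}.
HB.instance Definition _ := Choice.copy stage_elt {i : I & D i}.

Definition at_stage i (x : D i) : stage_elt := existT _ i x.

Definition germ_equiv (x y : stage_elt) : Prop :=
  exists (k : I) (xk : (tag x <= k)%O) (yk : (tag y <= k)%O),
    ds_map D xk (tagged x) = ds_map D yk (tagged y).

Definition germ_rel : rel stage_elt := fun x y => `[< germ_equiv x y >].

Lemma germ_rel_refl : reflexive germ_rel.
Proof. by move=> x; apply/asboolP; exists (tag x), (lexx _), (lexx _). Qed.

Lemma germ_rel_sym : symmetric germ_rel.
Proof.
by move=> x y; apply/asboolP/asboolP => -[k [h [h' e]]]; exists k, h', h.
Qed.

Lemma germ_rel_trans : transitive germ_rel.
Proof.
move=> y x z /asboolP[k [xk [yk xy]]] /asboolP[l [yl [zl yz]]]; apply/asboolP.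
have [m /andP[km lm]] := ub k l.
exists m, (le_trans xk km), (le_trans zl lm).
rewrite -(ds_map_comp xk km) xy -(ds_map_comp zl lm) -yz.
by rewrite !(ds_map_comp _ _ (le_trans yk km)).
Qed.

Canonical germ_equiv_rel :=
  EquivRel germ_rel germ_rel_refl germ_rel_sym germ_rel_trans.

Definition germs : Type := {eq_quot germ_equiv_rel}.
HB.instance Definition _ := Choice.copy germs {eq_quot germ_equiv_rel}.

Definition germ (i : I) (x : D i) : germs :=
  \pi_{eq_quot germ_equiv_rel} (at_stage x).
Definition germ_repr (a : germs) : stage_elt :=
  repr (a : {eq_quot germ_equiv_rel}).

Lemma germP i j (x : D i) (y : D j) :
  germ x = germ y <-> germ_equiv (at_stage x) (at_stage y).
Proof. by split=> [/eqmodP/asboolP//|xy]; apply/eqmodP/asboolP. Qed.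

Lemma germ_reprK a : germ (tagged (germ_repr a)) = a.
Proof.
rewrite -[RHS](reprK (a : {eq_quot germ_equiv_rel})) /germ /germ_repr.
by case: (repr _).
Qed.

Lemma germ_map i j (ij : (i <= j)%O) (x : D i) : germ (ds_map D ij x) = germ x.
Proof.
by apply/germP; exists j, (lexx j), ij; rewrite /= ds_map_id.
Qed.

(** Bringing germs to a common stage reduces the semiring laws to those of a single [D k]. *)
Lemma germ_at2 (a b : germs) : exists k (x y : D k), a = germ x /\ b = germ y.
Proof.
have [k /andP[ak bk]] := ub (tag (germ_repr a)) (tag (germ_repr b)).
exists k, (ds_map D ak (tagged (germ_repr a))),
  (ds_map D bk (tagged (germ_repr b))).
by rewrite !germ_map !germ_reprK.
Qed.

Lemma germ_at3 (a b c : germs) :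
  exists k (x y z : D k), [/\ a = germ x, b = germ y & c = germ z].
Proof.
have [i [x [y [-> ->]]]] := germ_at2 a b.
have [k /andP[ik ck]] := ub i (tag (germ_repr c)).
exists k, (ds_map D ik x), (ds_map D ik y),
  (ds_map D ck (tagged (germ_repr c))).
by rewrite !germ_map germ_reprK.
Qed.

Section Operations.
Variable op : forall i, D i -> D i -> D i.
Hypothesis op_map : forall i j (ij : (i <= j)%O) x y,
  ds_map D ij (op x y) = op (ds_map D ij x) (ds_map D ij y).

Definition germ_op (a b : germs) : germs :=
  let k := xchoose (ub (tag (germ_repr a)) (tag (germ_repr b))) in
  let ks := andP (xchooseP (ub (tag (germ_repr a)) (tag (germ_repr b)))) in
  germ (op (ds_map D (proj1 ks) (tagged (germ_repr a)))
           (ds_map D (proj2 ks) (tagged (germ_repr b)))).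

(** The chosen representatives agree with [x] and [y] at stages [l1] and [l2]. At a stage [m] above
    these and the chosen [k], both results coincide because [op] commutes with the transition
    maps. *)
Lemma germ_opE i (x y : D i) : germ_op (germ x) (germ y) = germ (op x y).
Proof.
rewrite /germ_op; set k := xchoose _; case: (andP _) => /=.
have /germP := germ_reprK (germ x); have /germP := germ_reprK (germ y).
case: (germ_repr (germ x)) => i1 x1; case: (germ_repr (germ y)) => j1 y1 /=.
move=> [l2 [/= jl [il2 yl]]] [l1 [/= il [il1 xl]]] ik jk.
have [l /andP[l1l l2l]] := ub l1 l2.
have [m /andP[lm km]] := ub l k.
have l1m := le_trans l1l lm; have l2m := le_trans l2l lm.
have im := le_trans il1 l1m.
rewrite -(germ_map km) -(germ_map im) !op_map; congr (germ (op _ _)).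
  by rewrite (ds_map_comp _ _ (le_trans il l1m)) -(ds_map_comp il l1m) xl
             (ds_map_comp _ _ im).
by rewrite (ds_map_comp _ _ (le_trans jl l2m)) -(ds_map_comp jl l2m) yl
           (ds_map_comp _ _ im).
Qed.

End Operations.

(** Again in boolean form, so that [xchoose] yields a stage [i0] from which 0 and 1 are taken. *)
Let pt : exists i : I, true.
Proof. by case: I_directed => [[i] _]; exists i. Qed.
Let i0 : I := xchoose pt.

Definition germ_add := @germ_op (fun i x y => x + y).
Definition germ_mul := @germ_op (fun i x y => x * y).

Lemma germ_addE i (x y : D i) : germ_add (germ x) (germ y) = germ (x + y).
Proof. by apply: germ_opE => j k jk u v; rewrite rmorphD. Qed.

Lemma germ_mulE i (x y : D i) : germ_mul (germ x) (germ y) = germ (x * y).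
Proof. by apply: germ_opE => j k jk u v; rewrite rmorphM. Qed.

Lemma germ0E i : germ (0 : D i) = germ (0 : D i0).
Proof.
have [k /andP[ik i0k]] := ub i i0.
by rewrite -(germ_map ik) -(germ_map i0k) !rmorph0.
Qed.

Lemma germ1E i : germ (1 : D i) = germ (1 : D i0).
Proof.
have [k /andP[ik i0k]] := ub i i0.
by rewrite -(germ_map ik) -(germ_map i0k) !rmorph1.
Qed.

Fact germ_addA : associative germ_add.
Proof.
move=> a b c; have [i [x [y [z [-> -> ->]]]]] := germ_at3 a b c.
by rewrite !germ_addE addrA.
Qed.

Fact germ_addC : commutative germ_add.
Proof.
move=> a b; have [i [x [y [-> ->]]]] := germ_at2 a b.
by rewrite !germ_addE addrC.
Qed.

Fact germ_add0 : left_id (germ (0 : D i0)) germ_add.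
Proof.
move=> a; have [i [x [_ [-> _]]]] := germ_at2 a a.
by rewrite -(germ0E i) germ_addE add0r.
Qed.

Fact germ_mulA : associative germ_mul.
Proof.
move=> a b c; have [i [x [y [z [-> -> ->]]]]] := germ_at3 a b c.
by rewrite !germ_mulE mulrA.
Qed.

Fact germ_mul1l : left_id (germ (1 : D i0)) germ_mul.
Proof.
move=> a; have [i [x [_ [-> _]]]] := germ_at2 a a.
by rewrite -(germ1E i) germ_mulE mul1r.
Qed.

Fact germ_mul1r : right_id (germ (1 : D i0)) germ_mul.
Proof.
move=> a; have [i [x [_ [-> _]]]] := germ_at2 a a.
by rewrite -(germ1E i) germ_mulE mulr1.
Qed.

Fact germ_mulDl : left_distributive germ_mul germ_add.
Proof.
move=> a b c; have [i [x [y [z [-> -> ->]]]]] := germ_at3 a b c.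
by rewrite !(germ_mulE, germ_addE) mulrDl.
Qed.

Fact germ_mulDr : right_distributive germ_mul germ_add.
Proof.
move=> a b c; have [i [x [y [z [-> -> ->]]]]] := germ_at3 a b c.
by rewrite !(germ_mulE, germ_addE) mulrDr.
Qed.

Fact germ_mul0l : left_zero (germ (0 : D i0)) germ_mul.
Proof.
move=> a; have [i [x [_ [-> _]]]] := germ_at2 a a.
by rewrite -(germ0E i) germ_mulE mul0r.
Qed.

Fact germ_mul0r : right_zero (germ (0 : D i0)) germ_mul.
Proof.
move=> a; have [i [x [_ [-> _]]]] := germ_at2 a a.
by rewrite -(germ0E i) germ_mulE mulr0.
Qed.

HB.instance Definition _ := GRing.isPzSemiRing.Build germs
  germ_addA germ_addC germ_add0 germ_mulA germ_mul1l germ_mul1r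
  germ_mulDl germ_mulDr germ_mul0l germ_mul0r.

Fact germ_nmod i : nmod_morphism (@germ i).
Proof. by split=> [|x y]; [exact: germ0E | rewrite -germ_addE]. Qed.

Fact germ_monoid i : monoid_morphism (@germ i).
Proof. by split=> [|x y]; [exact: germ1E | rewrite -germ_mulE]. Qed.

HB.instance Definition _ i := GRing.isNmodMorphism.Build (D i) germs (@germ i)
  (germ_nmod i).
HB.instance Definition _ i := GRing.isMonoidMorphism.Build (D i) germs (@germ i)
  (germ_monoid i).

Section Descent.
Variables (T : pzSemiRingType) (psi : forall i, {rmorphism D i -> T}).

(** The cocone proof is an argument so that the morphism instances declared below can recover it
    from the term. *)
Definition germ_descent (_ : cocone psi) (a : germs) : T :=
  psi (tag (germ_repr a)) (tagged (germ_repr a)).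

Hypothesis psi_cocone : cocone psi.
Local Notation descent := (germ_descent psi_cocone).

Lemma germ_descentE i (x : D i) : descent (germ x) = psi i x.
Proof.
have /germP := germ_reprK (germ x); rewrite /germ_descent.
case: (germ_repr (germ x)) => j y [k [/= jk [ik xy]]].
by rewrite -(psi_cocone jk) xy psi_cocone.
Qed.

Fact germ_descent_nmod : nmod_morphism descent.
Proof.
split=> [|a b]; first by rewrite germ_descentE rmorph0.
have [i [x [y [-> ->]]]] := germ_at2 a b.
by rewrite -rmorphD !germ_descentE rmorphD.
Qed.

Fact germ_descent_monoid : monoid_morphism descent.
Proof.
split=> [|a b]; first by rewrite germ_descentE rmorph1.
have [i [x [y [-> ->]]]] := germ_at2 a b.
by rewrite -rmorphM !germ_descentE rmorphM.
Qed.

HB.instance Definition _ := GRing.isNmodMorphism.Build germs T descent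
  germ_descent_nmod.
HB.instance Definition _ := GRing.isMonoidMorphism.Build germs T descent
  germ_descent_monoid.

End Descent.

End Germs.

(** * Lifting scalars, matrices and isomorphisms from the limit to a stage *)

Section DirectLimitElements.
Variables (d : Order.disp_t) (I : porderType d) (I_directed : directed I).
Variables (D : direct_system I) (S : pzSemiRingType).
Variables (phi : forall i : I, {rmorphism D i -> S}).
Hypothesis S_lim : is_direct_limit phi.

(** The universal property of [S] turns equalities in [S] into equalities of germs. *)
Let to_germs : exists u : {rmorphism S -> germs I_directed D},
  forall i x, u (phi i x) = germ I_directed x.
Proof.
have [_ univ] := S_lim.
have [|u [uE _]] := univ _
    (fun i => @germ _ _ I_directed D i : {rmorphism _ -> _}).
  by move=> i j ij x; exact: germ_map.
by exists u.
Qed.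

Lemma direct_limit_eq i (x y : D i) : phi i x = phi i y ->
  exists (k : I) (ik : (i <= k)%O), ds_map D ik x = ds_map D ik y.
Proof.
case: to_germs => u uE /(congr1 u); rewrite !uE => /germP[k [/= h [h' e]]].
(* The two proofs of i <= k given by [germP] coincide, since the order is boolean. *)
by exists k, h; rewrite e; congr (ds_map D _ y); exact: bool_irrelevance.
Qed.

(** Let v be the map from germs to [S] induced by [phi]. Both v u and the identity of [S] are
    compatible with [phi], so v u = id by uniqueness; and u s is the germ of some x. *)
Lemma direct_limit_surj s : exists i (x : D i), s = phi i x.
Proof.
have [phi_cocone univ] := S_lim; case: to_germs => u uE.
have [w [_ w_uniq]] := univ _ phi phi_cocone.
have vE := germ_descentE I_directed phi_cocone.
pose v : {rmorphism germs I_directed D -> S} := germ_descent phi_cocone.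
have vuw : v (u s) = w s.
  apply: (w_uniq (v \o u : {rmorphism S -> S})) => i x /=.
  by rewrite uE; exact: vE.
have -> : s = v (u s).
  by rewrite vuw; exact: (w_uniq (idfun : {rmorphism S -> S})).
have [i [x [_ [-> _]]]] := germ_at2 (u s) (u s).
by exists i, x; exact: vE.
Qed.

(** One bound serves the finitely many entries. The equality is given at all later stages [l], so
    that several equations can be combined; i <= l is asked separately, as [k] need not lie above
    [i] when there are no entries. *)
Lemma direct_limit_eq_mx i m n (A B : 'M[(D i)^c]_(m, n)) :
  map_mx (convr_morph (phi i)) A = map_mx (convr_morph (phi i)) B ->
  exists k : I, forall (l : I) (il : (i <= l)%O), (k <= l)%O ->
    map_mx (convr_morph (ds_map D il)) A = map_mx (convr_morph (ds_map D il)) B.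
Proof.
move=> /matrixP AB.
have /choice[f fP] (p : 'I_m * 'I_n) :
    exists k : I, exists ik : (i <= k)%O,
    ds_map D ik (A p.1 p.2) = ds_map D ik (B p.1 p.2).
  by apply: direct_limit_eq; have := AB p.1 p.2; rewrite !mxE.
have [k fk] := directed_fin_ub f I_directed.
exists k => l il kl; apply/matrixP => r s; rewrite !mxE /convr_morph.
have [ik e] := fP (r, s).
have fl := le_trans (fk (r, s)) kl.
by rewrite -!(ds_map_comp ik fl) e.
Qed.

(** Entries lift to various stages and are pushed to a common one. Asking for i <= k makes
    successive lifts comparable. *)
Lemma direct_limit_lift_mx i m n (A : 'M[S^c]_(m, n)) :
  exists (k : I) (B : 'M[(D k)^c]_(m, n)),
    (i <= k)%O /\ A = map_mx (convr_morph (phi k)) B.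
Proof.
have /choice[f fP] (p : 'I_m * 'I_n) :
    exists x : stage_elt D, A p.1 p.2 = phi (tag x) (tagged x).
  by have [j [x xE]] := direct_limit_surj (A p.1 p.2); exists (at_stage x).
have [k0 fk0] := directed_fin_ub (fun p => tag (f p)) I_directed.
have [k [k0k ik]] := I_directed.2 k0 i.
pose fk p := le_trans (fk0 p) k0k.
exists k, (\matrix_(r, s) ds_map D (fk (r, s)) (tagged (f (r, s)))); split=> //.
apply/matrixP => r s; rewrite !mxE /convr_morph S_lim.1.
exact: (fP (r, s)).
Qed.

Lemma map_phi_map i k (ik : (i <= k)%O) m n (A : 'M[(D i)^c]_(m, n)) :
  map_mx (convr_morph (phi k)) (map_mx (convr_morph (ds_map D ik)) A) =
  map_mx (convr_morph (phi i)) A.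
Proof. by apply/matrixP => r s; rewrite !mxE; exact: S_lim.1. Qed.

(** A lift [A] of [E] need not be idempotent, but AA = A holds in [S], hence at a later stage. *)
Lemma mx_retract_lift n (E : 'M[S^c]_n) (P : rSemiModType S) :
  mx_retract E P ->
  exists (k : I) (E' : 'M[(D k)^c]_n),
    E' *m E' = E' /\ isomorphic (base_change (fixed_rows E') (phi k)) P.
Proof.
move=> PE; have EE := mx_retract_idem PE; have [[i0] _] := I_directed.
have [i [A [_ EA]]] := direct_limit_lift_mx i0 E.
have /direct_limit_eq_mx[k AA] : map_mx (convr_morph (phi i)) (A *m A) =
    map_mx (convr_morph (phi i)) A by rewrite map_mxM -EA.
have [l [il kl]] := I_directed.2 i k.
have {}AA := AA l il kl; rewrite map_mxM in AA.
exists l, (map_mx (convr_morph (ds_map D il)) A); split=> //.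
by apply: base_change_fixed_rows_iso; rewrite // map_phi_map -EA.
Qed.

(** Complementarity consists of three equations between lifts; each holds from some stage on, and
    [l] lies above all three. *)
Lemma mx_retract_lift_complementary n (E F : 'M[S^c]_n) (P : rSemiModType S) :
  complementary E F -> mx_retract E P ->
  exists (k : I) (E' F' : 'M[(D k)^c]_n),
    complementary E' F' /\
    isomorphic (base_change (fixed_rows E') (phi k)) P.
Proof.
move=> [EF1 EF0 FE0] PE.
have [[i0] _] := I_directed.
have [i1 [A1 [_ EA1]]] := direct_limit_lift_mx i0 E.
(* Lifting [F] above the stage of [A1] lets [A1] be pushed to the same stage. *)
have [i [B [i1i FB]]] := direct_limit_lift_mx i1 F.
pose A := map_mx (convr_morph (ds_map D i1i)) A1.
have EA : E = map_mx (convr_morph (phi i)) A by rewrite map_phi_map.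
have /direct_limit_eq_mx[k1 AB1] : map_mx (convr_morph (phi i)) (A + B) =
    map_mx (convr_morph (phi i)) 1%:M by rewrite map_mxD -EA -FB map_mx1.
have /direct_limit_eq_mx[k2 AB0] : map_mx (convr_morph (phi i)) (A *m B) =
    map_mx (convr_morph (phi i)) 0 by rewrite map_mxM -EA -FB raddf0.
have /direct_limit_eq_mx[k3 BA0] : map_mx (convr_morph (phi i)) (B *m A) =
    map_mx (convr_morph (phi i)) 0 by rewrite map_mxM -EA -FB raddf0.
have [k12 [k1k k2k]] := I_directed.2 k1 k2.
have [k123 [k12k k3k]] := I_directed.2 k12 k3.
have [l [il kl]] := I_directed.2 i k123.
have k12l := le_trans k12k kl.
have {}AB1 := AB1 l il (le_trans k1k k12l); rewrite map_mxD map_mx1 in AB1.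
have {}AB0 := AB0 l il (le_trans k2k k12l); rewrite map_mxM raddf0 in AB0.
have {}BA0 := BA0 l il (le_trans k3k kl); rewrite map_mxM raddf0 in BA0.
exists l, (map_mx (convr_morph (ds_map D il)) A),
  (map_mx (convr_morph (ds_map D il)) B).
have AB : complementary (map_mx (convr_morph (ds_map D il)) A)
  (map_mx (convr_morph (ds_map D il)) B) by [].
split=> //; apply: base_change_fixed_rows_iso;
  first exact: complementary_idem AB.
by rewrite map_phi_map -EA.
Qed.

(** The isomorphism over [S] amounts to matrices with aFb = E and bEa = F; these lift to a stage
    above [i], and the two equations hold at a later one. *)
Lemma mx_retract_iso_at_stage (i : I) m n (E : 'M[(D i)^c]_m)
    (F : 'M[(D i)^c]_n) (P Q : rSemiModType (D i)) :
  mx_retract E P -> mx_retract F Q ->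
  isomorphic (base_change P (phi i)) (base_change Q (phi i)) ->
  exists (k : I) (ik : (i <= k)%O),
    isomorphic (base_change P (ds_map D ik)) (base_change Q (ds_map D ik)).
Proof.
move=> PE QF /(mx_retract_isoE (mx_retract_base_change (phi i) PE)
  (mx_retract_base_change (phi i) QF))[a [b [aFb bEa]]].
have [j1 [a1 [ij1 aE]]] := direct_limit_lift_mx i a.
have [j [b' [j1j bE]]] := direct_limit_lift_mx j1 b.
pose a' := map_mx (convr_morph (ds_map D j1j)) a1.
have ij := le_trans ij1 j1j.
pose E' := map_mx (convr_morph (ds_map D ij)) E.
pose F' := map_mx (convr_morph (ds_map D ij)) F.
have /direct_limit_eq_mx[k1 k1P] :
    map_mx (convr_morph (phi j)) (a' *m F' *m b') =
    map_mx (convr_morph (phi j)) E'.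
  by rewrite !map_mxM !map_phi_map -aE -bE.
have /direct_limit_eq_mx[k2 k2P] :
    map_mx (convr_morph (phi j)) (b' *m E' *m a') =
    map_mx (convr_morph (phi j)) F'.
  by rewrite !map_mxM !map_phi_map -aE -bE.
have [k [k1k k2k]] := I_directed.2 k1 k2.
have [l [jl kl]] := I_directed.2 j k.
have il := le_trans ij jl.
have comp r s (G : 'M[(D i)^c]_(r, s)) :
    map_mx (convr_morph (ds_map D jl)) (map_mx (convr_morph (ds_map D ij)) G) =
    map_mx (convr_morph (ds_map D il)) G.
  by apply/matrixP => u v; rewrite !mxE; exact: ds_map_comp.
have := k2P l jl (le_trans k2k kl); have := k1P l jl (le_trans k1k kl).
rewrite !map_mxM !comp => aFb' bEa'; exists l, il.
exact: mx_retract_iso (mx_retract_base_change _ PE)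
  (mx_retract_base_change _ QF) aFb' bEa'.
Qed.

End DirectLimitElements.

Theorem proposition4p10
    (d : Order.disp_t) (I : porderType d) (I_directed : directed I)
    (D : direct_system I) (S : pzSemiRingType)
    (phi : forall i : I, {rmorphism D i -> S})
    (S_lim : is_direct_limit phi) :
  ((forall P : rSemiModType S, fg_projective P ->
      exists (m : I) (Q : rSemiModType (D m)),
        fg_projective Q /\ isomorphic (base_change Q (phi m)) P)
   /\
   (forall P : rSemiModType S, fg_strongly_projective P ->
      exists (m : I) (Q : rSemiModType (D m)),
        fg_strongly_projective Q /\ isomorphic (base_change Q (phi m)) P))
  /\
  ((forall (i : I) (P Q : rSemiModType (D i)),
      fg_projective P -> fg_projective Q ->
      isomorphic (base_change P (phi i)) (base_change Q (phi i)) ->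
      exists (k : I) (le_ik : (i <= k)%O),
        isomorphic (base_change P (ds_map D le_ik))
                   (base_change Q (ds_map D le_ik)))
   /\
   (forall (i : I) (P Q : rSemiModType (D i)),
      fg_strongly_projective P -> fg_strongly_projective Q ->
      isomorphic (base_change P (phi i)) (base_change Q (phi i)) ->
      exists (k : I) (le_ik : (i <= k)%O),
        isomorphic (base_change P (ds_map D le_ik))
                   (base_change Q (ds_map D le_ik)))).

Proof.
split; split.
- move=> P /fg_projective_mx[n [E /(mx_retract_lift I_directed S_lim)]].
  move=> [m [E' [EE QP]]]; exists m, (fixed_rows E'); split=> //.
  exact: mx_fg_projective (fixed_rows_retract EE).
- move=> P /fg_strongly_projective_mx[n [E [F [EF PE]]]].
  have [m [E' [F' [EF' QP]]]] :=
    mx_retract_lift_complementary I_directed S_lim EF PE.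
  exists m, (fixed_rows E'); split=> //.
  exact: fixed_rows_strongly_projective EF'.
- move=> i P Q /fg_projective_mx[m [E PE]] /fg_projective_mx[n [F QF]].
  exact: (mx_retract_iso_at_stage I_directed S_lim PE QF).
- move=> i P Q /fg_strongly_projective_mx[m [E [_ [_ PE]]]].
  move=> /fg_strongly_projective_mx[n [F [_ [_ QF]]]].
  exact: (mx_retract_iso_at_stage I_directed S_lim PE QF).
Qed.
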